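(* Let $F$ be a field with a nontrivial valuation $v$ and valuation domain $O_v$, let $R$ be an $O_v$-algebra, and let $w$ be the filter quasi-valuation induced by $(R,v)$. Consider the following properties: (a) there exists an $F$-algebra $A$ such that $R$ is a subring of $A$ (with the $O_v$-algebra structure of $R$ the one induced from the $F$-algebra structure of $A$) and $R\cap F=O_v$; (b) $R$ is torsion-free over $O_v$ and $(R^{\times}\cap O_v)\subseteq O_v^{\times}$; (c) $w(a\cdot 1_R)=v(a)$ for all $a\in O_v$; (d) $R$ is faithful over $O_v$ and $((R_P)^{\times}\cap (O_v)_P)\subseteq ((O_v)_P)^{\times}$ for every $P\in\operatorname{Spec}(O_v)$; (e) $R$ satisfies LO (lying over) over $O_v$. Then (a) $\Leftrightarrow$ (b) $\Rightarrow$ (c) $\Rightarrow$ (d) $\Leftrightarrow$ (e).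
   Context: Rings are associative with $1$, not necessarily commutative; $\operatorname{Spec}(R)$ is the set of prime (two-sided) ideals of $R$. $\Gamma_v$ is the value group of $v$ (a totally ordered abelian group, written additively), $O_v=\{x\in F: v(x)\ge 0\}$. For a commutative ring $S$, an $S$-algebra is a ring $R$ with a unitary ring homomorphism $S\to Z(R)$, $s\mapsto s\cdot 1_R$. For a subset $I\subseteq R$ write $I\cap S=\{s\in S: s\cdot 1_R\in I\}$ (even if $R$ is not faithful over $S$); $I$ is lying over $J\subseteq S$ if $I\cap S=J$. In particular $R^\times\cap S=\{s\in S: s\cdot 1_R\in R^\times\}$. Likewise, in (a), $R\cap F=\{x\in F: x\cdot 1_A\in R\}$. $R$ satisfies LO over $S$ if for every $P\in\operatorname{Spec}(S)$ there is $Q\in\operatorname{Spec}(R)$ lying over $P$. $R$ is torsion-free over $O_v$ if $cr=0$ with $c\in O_v$, $r\in R$ implies $c=0$ or $r=0$. For $P\in\operatorname{Spec}(O_v)$, $R_P$ and $(O_v)_P$ denote the localizations at $O_v\setminus P$, and $R_P$ is viewed as an $(O_v)_P$-algebra. Cut monoid: a cut of $\Gamma_v$ is a pair $\mathcal A=(\mathcal A^L,\mathcal A^R)$ of disjoint subsets with union $\Gamma_v$ such that $\alpha<\beta$ for all $\alpha\in\mathcal A^L$, $\beta\in\mathcal A^R$. Cuts are ordered by $\mathcal A\le\mathcal B$ iff $\mathcal A^L\subseteq\mathcal B^L$ and added by $(\mathcal A+\mathcal B)^L=\mathcal A^L+\mathcal B^L$. The set $\mathcal M(\Gamma_v)$ of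 all cuts is a totally ordered abelian monoid with zero $((-\infty,0],(0,\infty))$; $\Gamma_v$ is identified with a submonoid through $\alpha\mapsto((-\infty,\alpha],(\alpha,\infty))$. One adjoins an element $\infty$ greater than all elements of $\mathcal M(\Gamma_v)$ (and $v(0)=\infty$). Filter quasi-valuation: for $x\in R$ let $S_x=\{a\in O_v: xR\subseteq aR\}$. For $x\neq 0$ put $v(S_x)=\{v(a): a\in S_x\}\cup\{\gamma\in\Gamma_v:\gamma<0\}$, an initial subset of $\Gamma_v$. The filter quasi-valuation induced by $(R,v)$ is $w:R\to\mathcal M(\Gamma_v)\cup\{\infty\}$ with $w(0)=\infty$ and $w(x)=(v(S_x),\Gamma_v\setminus v(S_x))$ for $x\ne 0$. *)

(* Defs.v *)
From HB Require Import structures.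
From mathcomp Require Import all_boot all_order all_algebra.
From mathcomp Require Import boolp classical_sets.

Set Implicit Arguments.
Unset Strict Implicit.
Unset Printing Implicit Defensive.

Import Order.TTheory GRing.Theory.

Local Open Scope classical_set_scope.
Local Open Scope ring_scope.
Local Open Scope quotient_scope.

Record orderedAbGroup := OrderedAbGroup {
  oag_carrier :> porderZmodType;
  oag_total : total (fun x y : oag_carrier => x <= y);
  oag_leD2l : forall z x y : oag_carrier, x <= y -> z + x <= z + y
}.

(* [option G] is G with an element [None] = oo adjoined on top. *)
Section AddInfinity.
Variable G : orderedAbGroup.
Implicit Types a b : option G.

Definition oo_add a b : option G :=
  if a is Some x then if b is Some y then Some (x + y) else None else None.

Definition oo_le a b : bool :=
  if b is Some y then if a is Some x then x <= y else false else true.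

Definition oo_min a b : option G := if oo_le a b then a else b.

End AddInfinity.

(* Surjectivity makes G the value group of the valuation. *)
Record valuation (F : fieldType) (G : orderedAbGroup) := Valuation {
  val_fun :> F -> option G;
  val_oo : forall x, val_fun x = None <-> x = 0;
  val_mul : forall x y, val_fun (x * y) = oo_add (val_fun x) (val_fun y);
  val_add : forall x y,
    oo_le (oo_min (val_fun x) (val_fun y)) (val_fun (x + y));
  val_surj : forall g : G, exists x, val_fun x = Some g
}.

Definition nontrivial_valuation (F : fieldType) (G : orderedAbGroup)
    (v : valuation F G) : Prop :=
  exists2 x : F, x != 0 & v x <> Some 0.

Section ValuationRing.
Variables (F : fieldType) (G : orderedAbGroup) (v : valuation F G).

Definition valring : {pred F} := fun x => oo_le (Some 0) (v x).

Lemma ordered_le_add (x y : G) : 0 <= x -> 0 <= y -> 0 <= x + y.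
Proof.
by move=> x0 y0; apply: le_trans x0 _; rewrite -{1}[x]addr0; apply: oag_leD2l.
Qed.

Lemma val_mul1 : v 1 = Some 0.
Proof.
have := val_mul v 1 1; rewrite mulr1.
case E : (v 1) => [g|] /=.
  by move=> [] /eqP; rewrite -{1}[g]addr0 => /eqP/addrI <-.
by move/(val_oo v): E => /eqP; rewrite oner_eq0.
Qed.

Lemma val_opp x : v (- x) = v x.
Proof.
have h1 : v (-1) = Some 0.
  have := val_mul v (-1) (-1); rewrite mulrNN mulr1 val_mul1.
  case: (v (-1)) => [g|] //= [] /esym gg; congr Some.
  case/orP: (oag_total 0 g) => g0; have := oag_leD2l g g0;
    by rewrite addr0 gg => g0'; apply/eqP; rewrite eq_le ?g0 ?g0'.
rewrite -mulN1r val_mul h1 /=.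
by case: (v x) => [g|] //=; rewrite add0r.
Qed.

Lemma valring_subring : subring_closed valring.
Proof.
split=> [|x y|x y]; rewrite !unfold_in /valring ?val_mul1 //=.
- move=> hx hy; have := val_add v x (- y); rewrite val_opp /oo_min.
  move: hx hy; case: (v x) (v y) (v (x - y)) => [a|] [b|] [c|] //=.
  + by case: ifP => _ a0 b0 h; [apply: le_trans a0 h|apply: le_trans b0 h].
  + by move=> a0 _ /(le_trans a0).
  + by move=> _ b0 /(le_trans b0).
- rewrite val_mul; case: (v x) (v y) => [a|] [b|] //=; exact: ordered_le_add.
Qed.

HB.instance Definition _ :=
  GRing.isSubringClosed.Build F valring valring_subring.

Record valuation_ring := ValuationRing {
  valr_val : F;
  valr_in : valr_val \in valring
}.

HB.instance Definition _ := [isSub for valr_val].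
HB.instance Definition _ := [Choice of valuation_ring by <:].
HB.instance Definition _ :=
  [SubChoice_isSubComNzRing of valuation_ring by <:].

End ValuationRing.

(* The library's [algType] excludes the zero ring, which is a legitimate
   algebra here and occurs as a localization. *)
Record algebra (S : comPzRingType) := Algebra {
  alg_ring :> pzRingType;
  alg_map : {rmorphism S -> alg_ring};
  alg_map_central : forall s r, alg_map s * r = r * alg_map s
}.

Definition unit_set (R : pzRingType) : set R :=
  [set x | exists y, x * y = 1 /\ y * x = 1].

Arguments unit_set : clear implicits.

Section Algebras.
Variables (S : comPzRingType) (R : algebra S).

(* Usually written as an intersection of I with S, although S need not embed
   in R. *)
Definition contraction (I : set R) : set S := [set s | I (alg_map R s)].

Definition faithful_algebra : Prop :=
  forall s : S, (forall r : R, alg_map R s * r = 0) -> s = 0.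

Definition torsion_free_algebra : Prop :=
  forall (s : S) (r : R), alg_map R s * r = 0 -> s = 0 \/ r = 0.

End Algebras.

Arguments contraction {S} R I _.

Section Spectrum.
Variable R : pzRingType.

Definition is_ideal (I : set R) : Prop :=
  [/\ I 0, (forall x y, I x -> I y -> I (x + y))
    & (forall r x, I x -> I (r * x) /\ I (x * r))].

(* The condition on I and J says that the product ideal IJ, which is generated
   additively by the products x * y, is contained in P. *)
Definition is_prime_ideal (P : set R) : Prop :=
  [/\ is_ideal P, P != setT
    & forall I J : set R, is_ideal I -> is_ideal J ->
        (forall x y, I x -> J y -> P (x * y)) -> I `<=` P \/ J `<=` P].

Record Spec := MkSpec {
  spec_set :> set R;
  specP : is_prime_ideal spec_set
}.

End Spectrum.

Definition lying_over (S : comPzRingType) (R : algebra S)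
  (I : set R) (J : set S) : Prop := contraction R I = J.

Definition satisfies_LO (S : comPzRingType) (R : algebra S) : Prop :=
  forall P : Spec S, exists Q : Spec R, lying_over Q P.

Section PrimeComplement.
Variables (S : comPzRingType) (P : Spec S).

Lemma prime_not1 : ~ spec_set P 1.
Proof.
move=> P1; have [[_ _ PM] /eqP PT _] := specP P.
by apply: PT; rewrite -subTset => x _; rewrite -[x]mulr1; case: (PM x 1 P1).
Qed.

Lemma prime_notM s t : ~ spec_set P s -> ~ spec_set P t -> ~ spec_set P (s * t).
Proof.
move=> Ps Pt Pst; have [[_ _ PM] _ PP] := specP P.
pose I a : set S := [set x | exists c, x = c * a].
have idI a : is_ideal (I a).
  split; first by exists 0; rewrite mul0r.
    by move=> x y [c ->] [d ->]; exists (c + d); rewrite mulrDl.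
  move=> r x [c ->]; split; first by exists (r * c); rewrite mulrA.
  by exists (c * r); rewrite mulrAC.
have [] := PP (I s) (I t) (idI s) (idI t).
- by move=> x y [c ->] [d ->]; rewrite mulrACA; case: (PM (c * d) _ Pst).
- by move/(_ s) => h; apply/Ps/h; exists 1; rewrite mul1r.
- by move/(_ t) => h; apply/Pt/h; exists 1; rewrite mul1r.
Qed.

Record denominator := Denominator {
  den_val : S;
  den_inP : `[< ~ spec_set P den_val >]
}.

HB.instance Definition _ := [isSub for den_val].
HB.instance Definition _ := [Choice of denominator by <:].

Definition den1 := Denominator (asboolT prime_not1).

Definition denM (s t : denominator) :=
  Denominator (asboolT (prime_notM (asboolW (den_inP s)) (asboolW (den_inP t)))).

End PrimeComplement.

Module Localization.
Section Localization.
Variables (S : comPzRingType) (R : algebra S) (P : Spec S).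

Definition frac : Type := (R * denominator P)%type.
HB.instance Definition _ := Choice.on frac.
Implicit Types (x y z : frac) (s t u : S) (a b : R).

Local Notation "s ** a" := (alg_map R s * a) (at level 40).

Lemma scA s t a : s ** (t ** a) = (s * t) ** a.
Proof. by rewrite rmorphM mulrA. Qed.

Lemma scC s t a : s ** (t ** a) = t ** (s ** a).
Proof. by rewrite !scA mulrC. Qed.

Lemma scl s a b : (s ** a) * b = s ** (a * b).
Proof. by rewrite mulrA. Qed.

Lemma scr s a b : a * (s ** b) = s ** (a * b).
Proof. by rewrite mulrA -alg_map_central mulrA. Qed.

Lemma sc1 a : 1 ** a = a.
Proof. by rewrite rmorph1 mul1r. Qed.

(* r/s = r'/s' when u (s' r - s r') = 0 for some denominator u. *)
Definition equivf : rel frac := fun x y =>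
  `[< exists u : denominator P, den_val u ** (den_val y.2 ** x.1) = den_val u ** (den_val x.2 ** y.1) >].

Lemma equivfP x y :
  (exists u : denominator P, den_val u ** (den_val y.2 ** x.1) = den_val u ** (den_val x.2 ** y.1)) ->
  equivf x y.
Proof. by move=> h; apply/asboolP. Qed.

Lemma equivf_refl : reflexive equivf.
Proof. by move=> x; apply: equivfP; exists (den1 P). Qed.

Lemma equivf_sym : symmetric equivf.
Proof.
by move=> x y; apply/asboolP/asboolP => -[u e]; exists u; rewrite e.
Qed.

Lemma equivf_trans : transitive equivf.
Proof.
move=> y x z /asboolP[u e1] /asboolP[w e2]; apply: equivfP.
exists (denM (denM u w) y.2); rewrite /=.
move: (den_val u) (den_val w) (den_val x.2) (den_val y.2) (den_val z.2) e1 e2.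
move=> {}u {}w sx sy sz e1 e2.
transitivity ((w * sz) ** (u ** (sy ** x.1))).
  by rewrite !scA; congr (alg_map R _ * _); rewrite ?mulrA [LHS](ACl (2*4*1*3)).
rewrite e1; transitivity ((u * sx) ** (w ** (sz ** y.1))).
  by rewrite !scA; congr (alg_map R _ * _); rewrite ?mulrA [LHS](ACl (3*4*1*2)).
rewrite e2 !scA; congr (alg_map R _ * _).
by rewrite ?mulrA [LHS](ACl (1*3*4*2)).
Qed.

Lemma equivf_frac a b (s t : denominator P) :
  den_val t ** a = den_val s ** b -> equivf (a, s) (b, t).
Proof. by move=> e; apply: equivfP; exists (den1 P); rewrite /= e. Qed.

Canonical equivf_equiv := EquivRel equivf equivf_refl equivf_sym equivf_trans.

Definition type : Type := {eq_quot equivf}.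
HB.instance Definition _ : EqQuotient frac equivf type := EqQuotient.on type.
HB.instance Definition _ := Choice.on type.

Lemma repr_equivf x : equivf x (repr (\pi_type x)).
Proof. by apply/eqmodP; rewrite reprK. Qed.

Definition zerof : frac := (0, den1 P).
Definition onef : frac := (1, den1 P).
Definition addf x y : frac :=
  (den_val y.2 ** x.1 + den_val x.2 ** y.1, denM x.2 y.2).
Definition oppf x : frac := (- x.1, x.2).
Definition mulf x y : frac := (x.1 * y.1, denM x.2 y.2).

Definition zero : type := lift_cst type zerof.
Definition one : type := lift_cst type onef.
Definition add := lift_op2 type addf.
Definition opp := lift_op1 type oppf.
Definition mul := lift_op2 type mulf.

Canonical pi_zero_morph := PiConst zero.
Canonical pi_one_morph := PiConst one.

Lemma pi_add : {morph \pi : x y / addf x y >-> add x y}.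
Proof.
move=> x y; unlock add; apply/eqmodP => /=.
move: (repr_equivf x) (repr_equivf y).
move: (repr (\pi_type x)) (repr (\pi_type y)) => x' y' /asboolP[u e1] /asboolP[w e2].
apply: equivfP; exists (denM u w) => /=; rewrite !mulrDr !scA.
move: (den_val u) (den_val w) (den_val x.2) (den_val y.2)
  (den_val x'.2) (den_val y'.2) e1 e2 => {}u {}w sx sy sx' sy' e1 e2.
congr (_ + _).
  transitivity ((w * sy' * sy) ** (u ** (sx' ** x.1))).
    by rewrite !scA; congr (alg_map R _ * _);
      rewrite ?mulrA [LHS](ACl (2*4*5*1*3)).
  rewrite e1 !scA; congr (alg_map R _ * _).
  by rewrite ?mulrA [LHS](ACl (4*1*5*3*2)).
transitivity ((u * sx' * sx) ** (w ** (sy' ** y.1))).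
  by rewrite !scA; congr (alg_map R _ * _);
    rewrite ?mulrA [LHS](ACl (1*3*5*2*4)).
rewrite e2 !scA; congr (alg_map R _ * _).
by rewrite ?mulrA [LHS](ACl (1*4*3*5*2)).
Qed.
Canonical pi_add_morph := PiMorph2 pi_add.

Lemma pi_opp : {morph \pi : x / oppf x >-> opp x}.
Proof.
move=> x; unlock opp; apply/eqmodP => /=.
case/asboolP: (repr_equivf x) => u e.
by apply: equivfP; exists u; rewrite /= !mulrN e.
Qed.
Canonical pi_opp_morph := PiMorph1 pi_opp.

Lemma pi_mul : {morph \pi : x y / mulf x y >-> mul x y}.
Proof.
move=> x y; unlock mul; apply/eqmodP => /=.
move: (repr_equivf x) (repr_equivf y).
move: (repr (\pi_type x)) (repr (\pi_type y)) => x' y' /asboolP[u e1] /asboolP[w e2].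
apply: equivfP; exists (denM u w) => /=; rewrite !scA.
move: (den_val u) (den_val w) (den_val x.2) (den_val y.2)
  (den_val x'.2) (den_val y'.2) e1 e2 => {}u {}w sx sy sx' sy' e1 e2.
transitivity ((u ** (sx' ** x.1)) * (w ** (sy' ** y.1))).
  rewrite !scA scl scr !scA; congr (alg_map R _ * _).
  by rewrite ?mulrA [LHS](ACl (1*3*2*4)).
rewrite e1 e2 !scA scl scr !scA; congr (alg_map R _ * _).
by rewrite ?mulrA [LHS](ACl (1*3*2*4)).
Qed.
Canonical pi_mul_morph := PiMorph2 pi_mul.

Lemma eq_frac a b (s t : denominator P) :
  den_val t ** a = den_val s ** b -> \pi_type (a, s) = \pi_type (b, t).
Proof. by move=> /equivf_frac e; apply/eqmodP. Qed.

Lemma addA : associative add.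
Proof.
elim/quotW=> x; elim/quotW=> y; elim/quotW=> z; rewrite !piE /addf /=.
apply: eq_frac => /=; rewrite mulrA; congr (alg_map R _ * _).
rewrite !mulrDr !scA addrA; congr (_ + _ + _).
- by rewrite mulrC.
- by rewrite mulrC.
Qed.

Lemma addC : commutative add.
Proof.
elim/quotW=> x; elim/quotW=> y; rewrite !piE /addf /=.
by apply: eq_frac => /=; rewrite addrC mulrC.
Qed.

Lemma add0 : left_id zero add.
Proof.
elim/quotW=> x; rewrite !piE /addf /=; rewrite [in RHS](surjective_pairing x).
by apply: eq_frac; rewrite /= mulr0 add0r sc1 mul1r.
Qed.

Lemma addN : left_inverse zero opp add.
Proof.
elim/quotW=> x; rewrite !piE /addf /oppf /=.
by apply: eq_frac; rewrite /= mulrN addNr !mulr0.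
Qed.

HB.instance Definition _ := GRing.isZmodule.Build type addA addC add0 addN.

Lemma mulA : associative mul.
Proof.
elim/quotW=> x; elim/quotW=> y; elim/quotW=> z; rewrite !piE /mulf /=.
by apply: eq_frac; rewrite /= !mulrA.
Qed.

Lemma mul1 : left_id one mul.
Proof.
elim/quotW=> x; rewrite !piE /mulf /= [in RHS](surjective_pairing x).
by apply: eq_frac; rewrite /= !mul1r.
Qed.

Lemma mulx1 : right_id one mul.
Proof.
elim/quotW=> x; rewrite !piE /mulf /= [in RHS](surjective_pairing x).
by apply: eq_frac; rewrite /= !mulr1.
Qed.

Lemma mulDl : left_distributive mul add.
Proof.
elim/quotW=> x; elim/quotW=> y; elim/quotW=> z; rewrite !piE /mulf /addf /=.
apply: eq_frac => /=; rewrite mulrDl !scl mulrDr [RHS]mulrDr !scA.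
by congr (alg_map R _ * _ + alg_map R _ * _);
  rewrite ?mulrA [LHS](ACl (1*3*2*5*4)) ?mulrA.
Qed.

Lemma mulDr : right_distributive mul add.
Proof.
elim/quotW=> x; elim/quotW=> y; elim/quotW=> z; rewrite !piE /mulf /addf /=.
apply: eq_frac => /=; rewrite mulrDr !scr mulrDr [RHS]mulrDr !scA.
by congr (alg_map R _ * _ + alg_map R _ * _);
  rewrite ?mulrA [LHS](ACl (1*2*4*3*5)) ?mulrA.
Qed.

HB.instance Definition _ :=
  GRing.Zmodule_isPzRing.Build type mulA mul1 mulx1 mulDl mulDr.

Lemma frac_add x y : \pi_type x + \pi_type y = \pi_type (addf x y).
Proof. by rewrite pi_add. Qed.

Lemma frac_opp x : - \pi_type x = \pi_type (oppf x).
Proof. by rewrite pi_opp. Qed.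

Lemma frac_mul x y : \pi_type x * \pi_type y = \pi_type (mulf x y).
Proof. by rewrite pi_mul. Qed.

Lemma frac1 : (1 : type) = \pi_type onef.
Proof. by rewrite [LHS]piE. Qed.

End Localization.
End Localization.
HB.export Localization.

Definition self_algebra (S : comPzRingType) : algebra S :=
  @Algebra S S idfun (@mulrC S).

(* S_P *)
Definition local_ring (S : comPzRingType) (P : Spec S) : Type :=
  Localization.type (self_algebra S) P.

Section LocalRing.
Variables (S : comPzRingType) (P : Spec S).

HB.instance Definition _ := GRing.PzRing.on (local_ring P).

Lemma local_mulC : commutative (@GRing.mul (local_ring P)).
Proof.
elim/quotW=> x; elim/quotW=> y; rewrite ![LHS]Localization.frac_mul.
rewrite [RHS]Localization.frac_mul; apply: Localization.eq_frac => /=.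
by rewrite (mulrC x.1) (mulrC (den_val x.2)).
Qed.

HB.instance Definition _ :=
  GRing.PzRing_hasCommutativeMul.Build (local_ring P) local_mulC.

End LocalRing.

(* R_P with its structure map S_P -> R_P, s/t |-> (s 1_R)/t *)
Section LocalAlgebra.
Variables (S : comPzRingType) (R : algebra S) (P : Spec S).

Definition local_alg_map (x : local_ring P) : Localization.type R P :=
  let y : Localization.frac (self_algebra S) P := repr x in
  \pi_(Localization.type R P) (alg_map R y.1, y.2).

Lemma local_alg_map_pi (s : S) (t : denominator P) :
  local_alg_map (\pi_(local_ring P) (s, t)) = \pi_(Localization.type R P) (alg_map R s, t).
Proof.
rewrite /local_alg_map; apply/esym/eqmodP.
have /asboolP[u /= e] := Localization.repr_equivf (R := self_algebra S) (s, t).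
apply: Localization.equivfP; exists u => /=.
by rewrite -!rmorphM; congr (alg_map R _).
Qed.

Lemma local_alg_map_zmod : zmod_morphism local_alg_map.
Proof.
elim/quotW=> -[s t]; elim/quotW=> -[s' t'].
rewrite [X in local_alg_map (_ + X)]Localization.frac_opp.
rewrite [X in local_alg_map X]Localization.frac_add !local_alg_map_pi.
rewrite Localization.frac_opp Localization.frac_add.
by congr (\pi_(_) (_, _)); rewrite /= rmorphD !rmorphM rmorphN.
Qed.

Lemma local_alg_map_monoid : monoid_morphism local_alg_map.
Proof.
split.
  rewrite [X in local_alg_map X]Localization.frac1 local_alg_map_pi /= rmorph1.
  by rewrite -Localization.frac1.
elim/quotW=> -[s t]; elim/quotW=> -[s' t'].
rewrite [X in local_alg_map X]Localization.frac_mul !local_alg_map_pi.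
by rewrite Localization.frac_mul /Localization.mulf /= rmorphM.
Qed.

HB.instance Definition _ :=
  GRing.isZmodMorphism.Build (local_ring P) (Localization.type R P)
    local_alg_map local_alg_map_zmod.
HB.instance Definition _ :=
  GRing.isMonoidMorphism.Build (local_ring P) (Localization.type R P)
    local_alg_map local_alg_map_monoid.

Lemma local_alg_map_central x y : local_alg_map x * y = y * local_alg_map x.
Proof.
elim/quotW: x => -[s t]; elim/quotW: y => -[r t'].
rewrite local_alg_map_pi !Localization.frac_mul.
by apply: Localization.eq_frac; rewrite /= [den_val t * _]mulrC alg_map_central
  [RHS]alg_map_central (alg_map_central s).
Qed.

Definition local_algebra : algebra (local_ring P) :=
  @Algebra (local_ring P) (Localization.type R P) local_alg_map
    local_alg_map_central.

End LocalAlgebra.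

(* The sets [cutL] and [cutR] may be empty. *)
Record cut (G : orderedAbGroup) := Cut {
  cutL : set G;
  cutR : set G;
  cut_disjoint : cutL `&` cutR = set0;
  cut_cover : cutL `|` cutR = setT;
  cut_lt : forall a b, cutL a -> cutR b -> a < b
}.

Section Cuts.
Variable G : orderedAbGroup.

Lemma initial_cut_lt (L : set G) :
  (forall a b, L b -> a < b -> L a) ->
  forall a b, L a -> (~` L) b -> a < b.
Proof.
move=> Linit a b La Lb; case/orP: (oag_total a b) => ab.
  by rewrite lt_neqAle ab andbT; apply/eqP => e; apply: Lb; rewrite -e.
case: (eqVneq b a) => [e|ne]; first by case: Lb; rewrite e.
by case: Lb; apply: (Linit _ a) => //; rewrite lt_neqAle ne.
Qed.

Definition initial_cut (L : set G) (Linit : forall a b, L b -> a < b -> L a) :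
  cut G := Cut (setICr L) (setUv L) (initial_cut_lt Linit).

Lemma principal_initial (g a b : G) :
  [set x | x <= g] b -> a < b -> [set x | x <= g] a.
Proof. by move=> /= bg ab; apply: le_trans (ltW ab) bg. Qed.

(* ((-oo, g], (g, +oo)) *)
Definition principal_cut (g : G) : cut G :=
  initial_cut (@principal_initial g).

End Cuts.

Section FilterQuasiValuation.
Variables (F : fieldType) (G : orderedAbGroup) (v : valuation F G).
Variable R : algebra (valuation_ring v).

(* S_x = {a in O_v : xR subset aR} *)
Definition support_set (x : R) : set (valuation_ring v) :=
  [set a | [set x * r | r in [set: R]] `<=` [set alg_map R a * r | r in [set: R]]].

Definition support_values (x : R) : set G :=
  [set g | exists2 a, support_set x a & v (valr_val a) = Some g] `|`
  [set g | g < 0].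

Lemma support_values_initial (x : R) (g h : G) :
  support_values x h -> g < h -> support_values x g.
Proof.
move=> [[a Sa va]|/= h0] gh; last by right => /=; apply: lt_trans gh h0.
case/orP: (oag_total 0 g) => g0; last first.
  case: (eqVneq g 0) => [g0E|ne]; last by right; rewrite /= lt_neqAle ne.
  left; exists 1; last by rewrite g0E; exact: val_mul1.
  by move=> _ [r _ <-]; exists (x * r) => //; rewrite rmorph1 mul1r.
have [d vd] := val_surj v g.
have d0 : d != 0.
  by apply/eqP => /(val_oo v); rewrite vd.
have dO : d \in valring v by rewrite unfold_in /valring vd.
have cO : valr_val a / d \in valring v.
  rewrite unfold_in /valring; have := val_mul v (valr_val a / d) d.
  rewrite divfK // va vd; case: (v _) => [c|] //= [hE].
  case/orP: (oag_total 0 c) => // c0.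
  have := oag_leD2l g c0; rewrite addr0 addrC -hE => hg.
  by have := lt_le_trans gh hg; rewrite ltxx.
left; exists (ValuationRing dO) => //.
have aE : a = ValuationRing dO * ValuationRing cO.
  by apply: val_inj; rewrite rmorphM /= mulrC divfK.
move=> y /Sa[r _ <-]; exists (alg_map R (ValuationRing cO) * r) => //.
by rewrite mulrA -rmorphM -aE.
Qed.

Definition support_cut (x : R) : cut G :=
  initial_cut (fun g h => @support_values_initial x g h).

Definition filter_quasi_valuation (x : R) : option (cut G) :=
  if x == 0 then None else Some (support_cut x).

End FilterQuasiValuation.

(* Main.v *)
Require Import Defs.
From HB Require Import structures.
From mathcomp Require Import all_boot all_order all_algebra.
From mathcomp Require Import boolp classical_sets.

(** The implications rest on two ideas.

    For (a) and (b), the smallest candidate for A is the localization of R at the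
    nonzero elements of O_v, which is an algebra over F, the fraction field of
    O_v ([generic_fibre]).  R embeds in it exactly when R is torsion-free, and an
    element x of F outside O_v falls into R exactly when the non-unit x^-1 of O_v
    becomes a unit of R ([torsion_free_units_embedded]).  An arbitrary A gives the
    same two conditions, since nonzero scalars are invertible in it
    ([embedded_torsion_free_units]).

    For (c), (d) and (e), all three are compared with one condition on a prime
    P of O_v ([separates_prime]): an equality p r = q 1 in R with p in P forces q
    in P.  A prime of R over P gives this condition at once.  Conversely, since
    divisibility in O_v is total, PR consists of the products p r; the condition
    says that PR avoids the image of the complement of P, and Zorn's lemma
    extends PR to a prime that still avoids it ([separates_lying_over]).  Clearing
    denominators translates the condition into the one on units of R_P
    ([separates_prime_unitP]).  Finally (c) gives it because p r = q 1 puts v(p)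
    below w(q 1) = v(q), so p divides q ([quasi_valuation_scalars_separates]).

    Between the two groups, (b) implies (c): if a 1 = b r and b does not divide a,
    then b = a c, and cancelling the torsion-free scalar a makes c a unit
    ([filter_quasi_valuation_scalars]). *)

Set Implicit Arguments.
Unset Strict Implicit.
Unset Printing Implicit Defensive.

Import Order.TTheory GRing.Theory.

Local Open Scope classical_set_scope.
Local Open Scope ring_scope.
Local Open Scope quotient_scope.

(** * Prime ideals avoiding a multiplicative set *)

Lemma prime_mulr (S : comPzRingType) (P : Spec S) (s t : S) :
  spec_set P t -> spec_set P (s * t).
Proof. by move=> Pt; have [[_ _ PM] _ _] := specP P; case: (PM s t Pt). Qed.

Lemma ideal_sum (R : pzRingType) (I J : set R) : is_ideal I -> is_ideal J ->
  is_ideal [set x | exists a b, [/\ I a, J b & x = a + b]].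
Proof.
move=> [I0 ID IM] [J0 JD JM]; split.
- by exists 0, 0; rewrite addr0.
- move=> _ _ [a [b [Ia Jb ->]]] [c [d [Ic Jd ->]]].
  by exists (a + c), (b + d); split; [exact: ID|exact: JD|rewrite addrACA].
- move=> r _ [a [b [Ia Jb ->]]].
  have [? ?] := IM r a Ia; have [? ?] := JM r b Jb.
  by split; [exists (r * a), (r * b); rewrite mulrDr
            |exists (a * r), (b * r); rewrite mulrDl].
Qed.

(** Zorn's lemma is applied to the sets X for which the union of X and I is an
    ideal that avoids M, and not to the ideals themselves: the empty chain has
    the empty union, which is then admissible. *)
Lemma exists_maximal_ideal_avoiding (R : pzRingType) (I M : set R) :
    is_ideal I -> (forall x, I x -> ~ M x) ->
  exists Q : set R, [/\ is_ideal Q, I `<=` Q, forall x, Q x -> ~ M x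
    & forall J, is_ideal J -> Q `<=` J -> (forall x, J x -> ~ M x) -> J `<=` Q].
Proof.
move=> idI IM.
pose good (X : set R) := is_ideal (X `|` I) /\ forall x, (X `|` I) x -> ~ M x.
have chain_good (C : set (set R)) : C `<=` good -> total_on C subset ->
    good (\bigcup_(X in C) X).
  move=> goodC Ctot.
  have [I0 ID IMul] := idI.
  have in_C x : (\bigcup_(X in C) X `|` I) x ->
      I x \/ exists2 X, C X & (X `|` I) x.
    by case=> [[X CX Xx]|Ix]; [right; exists X => //; left|left].
  have of_C X x : C X -> (X `|` I) x -> (\bigcup_(X in C) X `|` I) x.
    by move=> CX [Xx|Ix]; [left; exists X|right].
  split; last first.
    move=> x /in_C[/IM //|[X CX Xx]]; have [_] := goodC _ CX; exact.
  split; first by right.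
    move=> x y /in_C[Ix|[X CX Xx]] /in_C[Iy|[Y CY Yy]].
    + by right; apply: ID.
    + have [[_ YD _] _] := goodC _ CY; apply: (of_C Y) => //.
      by apply: YD => //; right.
    + have [[_ XD _] _] := goodC _ CX; apply: (of_C X) => //.
      by apply: XD => //; right.
    + have [[_ XD _] _] := goodC _ CX; have [[_ YD _] _] := goodC _ CY.
      case: (Ctot X Y CX CY) => XY.
        by apply: (of_C Y) => //; apply: YD => //; apply: setSU Xx.
      by apply: (of_C X) => //; apply: XD => //; apply: setSU Yy.
  move=> r x /in_C[/(IMul r)[]|[X CX Xx]]; first by split; right.
  have [[_ _ XM] _] := goodC _ CX; have [] := XM r x Xx.
  by move=> *; split; apply: (of_C X).
have [Q [[idQ QM] Qmax]] := Zorn_bigcup chain_good.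
exists (Q `|` I); split; [by []|by move=> x Ix; right|by []|move=> J idJ QJ JM].
have JI : J `|` I = J.
  by apply/seteqP; split=> [x [//|Ix]|x]; [apply: QJ; right|left].
have [JQ|/existsNP[x /not_implyP[Jx Qx]]] := pselect (J `<=` Q).
  by move=> x /JQ; left.
case: (Qmax J); last by rewrite /good JI.
by split; [move=> y Qy; apply: QJ; left|move=> /(_ x Jx)].
Qed.

(** An ideal Q maximal among those that avoid M is prime: if neither J nor K is
    contained in Q, then Q + J and Q + K both meet M, and the product of two such
    elements lies in M and in Q + JK. *)
Lemma exists_prime_avoiding (R : pzRingType) (I M : set R) :
    is_ideal I -> M 1 -> (forall x y, M x -> M y -> M (x * y)) ->
    (forall x, I x -> ~ M x) ->
  exists2 Q : Spec R, I `<=` Q & forall x, spec_set Q x -> ~ M x.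
Proof.
move=> idI M1 MM IM.
have [Q [idQ IQ QM Qmax]] := exists_maximal_ideal_avoiding idI IM.
suff pQ : is_prime_ideal Q by exists (MkSpec pQ).
split=> //; first by apply/eqP => QT; apply: (QM 1) => //; rewrite QT.
have meets J : is_ideal J -> ~ (J `<=` Q) ->
    exists q j, [/\ Q q, J j & M (q + j)].
  move=> idJ nJQ; apply: contrapT => noM; apply: nJQ.
  have [Q0 QD _] := idQ; have [J0 _ _] := idJ.
  apply: subset_trans (Qmax _ (ideal_sum idQ idJ) _ _).
  - by move=> j Jj; exists 0, j; rewrite add0r.
  - by move=> q Qq; exists q, 0; rewrite addr0.
  - by move=> _ [q [j [Qq Jj ->]]] Mqj; apply: noM; exists q, j.
(* (q + j) (p + k) lies in M, and its four terms lie in Q. *)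
move=> J K idJ idK JK; apply: contrapT => /not_orP[].
move=> /(meets _ idJ)[q [j [Qq Jj Mj]]] /(meets _ idK)[p [k [Qp Kk Mk]]].
apply: (QM _ _ (MM _ _ Mj Mk)); have [_ QD QMul] := idQ.
rewrite mulrDl !mulrDr; apply: (QD); last first.
  by apply: QD; [case: (QMul j p Qp)|exact: JK].
by apply: QD; [case: (QMul p q Qq)|case: (QMul k q Qq)].
Qed.

(** * Separating a prime from its complement *)

Section PrimeSeparation.
Variables (S : comPzRingType) (R : algebra S).

(** This is the condition through which (c), (d) and (e) are compared.  When
    S is a valuation ring, every element of the extended ideal PR has the form
    p r with p in P, so the condition says that PR contracts into P. *)
Definition separates_prime (P : Spec S) : Prop :=
  forall (p q : S) (r : R),
    spec_set P p -> alg_map R p * r = alg_map R q -> spec_set P q.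

End PrimeSeparation.

Section LocalFractions.
Variables (S : comPzRingType) (R : algebra S).

Lemma pi_eqP (P : Spec S) (a b : R) (s t : denominator P) :
  \pi_(Localization.type R P) (a, s) = \pi_(Localization.type R P) (b, t) ->
  exists2 u, ~ spec_set P u &
    alg_map R (u * den_val t) * a = alg_map R (u * den_val s) * b.
Proof.
move=> /eqmodP/asboolP[u /= e]; exists (den_val u); first exact: asboolW (den_inP u).
by rewrite !rmorphM -!mulrA.
Qed.

Lemma pi_eq1 (P : Spec S) (a : R) (s : denominator P) :
  alg_map R (den_val s) = a -> \pi_(Localization.type R P) (a, s) = 1.
Proof.
move=> e; rewrite Localization.frac1; apply: Localization.eq_frac.
by rewrite /= rmorph1 mul1r mulr1.
Qed.

End LocalFractions.

Section SeparationCriteria.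
Variables (S : comPzRingType) (R : algebra S).

(** If s/t becomes a unit of R_P with inverse r/t', clearing denominators gives
    u s r = u t t' in R, where u t t' avoids P; separation then forces s to avoid
    P, and t/s is an inverse in S_P.  Conversely, from p r = q with q outside P,
    r/q is an inverse of p/1 in R_P, so p/1 is a unit of S_P and p is not in P. *)
Lemma separates_prime_unitP (P : Spec S) :
  separates_prime R P <->
  contraction (local_algebra R P) (unit_set (local_algebra R P))
    `<=` unit_set (local_ring P).
Proof.
split=> [sepP|unitP p q r Pp pr].
  elim/quotW=> -[s t] [y []]; elim/quotW: y => -[r t'].
  rewrite [alg_map _ _]local_alg_map_pi [LHS]Localization.frac_mul => + _.
  rewrite Localization.frac1 => /pi_eqP[u Pu /=]; rewrite mulr1 mulrA.
  rewrite -rmorphM mulr1 => e.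
  have Ps : ~ spec_set P s.
    move=> Ps; have /sepP : spec_set P (u * s) by apply: prime_mulr.
    by move=> /(_ _ _ e); apply: prime_notM Pu (asboolW (den_inP (denM t t'))).
  exists (\pi_(local_ring P) (den_val t, Denominator (asboolT Ps))).
  split; rewrite [LHS]Localization.frac_mul.
    by apply: (@pi_eq1 _ (self_algebra S)); rewrite /= mulrC.
  by apply: (@pi_eq1 _ (self_algebra S)); rewrite /= mulrC.
apply: contrapT => Pq.
have : unit_set (local_ring P) (\pi_(local_ring P) (p, den1 P)).
  apply: unitP; exists (\pi_(Localization.type R P) (r, Denominator (asboolT Pq))).
  rewrite [alg_map _ _]local_alg_map_pi.
  split; rewrite [LHS]Localization.frac_mul; apply: pi_eq1 => /=.
    by rewrite mul1r.
  by rewrite -alg_map_central mulr1.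
case=> y []; elim/quotW: y => -[a t]; rewrite [LHS]Localization.frac_mul => + _.
rewrite Localization.frac1 => /(pi_eqP (R := self_algebra S))[u Pu /=].
rewrite !mulr1 mul1r => e.
apply: (prime_notM Pu (asboolW (den_inP t))); rewrite -e mulrCA mulrC.
exact: prime_mulr.
Qed.

Lemma lying_over_separates (P : Spec S) (Q : Spec R) :
  lying_over Q P -> separates_prime R P.
Proof.
rewrite /lying_over => QP p q r; rewrite -QP /contraction /= => Qp <-.
by have [[_ _ QM] _ _] := specP Q; case: (QM r _ Qp).
Qed.

End SeparationCriteria.

(** * Divisibility in a valuation ring *)

Section ValuationRingArithmetic.
Variables (F : fieldType) (G : orderedAbGroup) (v : valuation F G).
Local Notation Ov := (valuation_ring v).
Implicit Types (a b c s t : Ov) (x : F).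

Lemma valr_val_inj : injective (@valr_val F G v).
Proof. exact: (@val_inj _ _ Ov). Qed.

Lemma valr_val_eq0 a : valr_val a = 0 -> a = 0.
Proof. by move=> a0; apply: valr_val_inj. Qed.

Lemma valr_valM a b : valr_val (a * b) = valr_val a * valr_val b.
Proof. exact: (rmorphM (val : Ov -> F)). Qed.

Lemma valuation_ring_domain a b : a * b = 0 -> a = 0 \/ b = 0.
Proof.
move=> /(congr1 (@valr_val F G v)); rewrite valr_valM => /eqP.
by rewrite mulf_eq0 => /orP[] /eqP/valr_val_eq0; [left|right].
Qed.

Lemma oo_le_total (p q : option G) : oo_le p q \/ oo_le q p.
Proof.
by case: p q => [g|] [h|] /=; [exact/orP/oag_total|left|right|left].
Qed.

Lemma dvd_valP a b :
  (exists c, a = b * c) <-> oo_le (v (valr_val b)) (v (valr_val a)).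
Proof.
split=> [[c ->]|ba].
  rewrite valr_valM val_mul.
  have /= := valr_in c; rewrite unfold_in /valring.
  case: (v (valr_val b)) (v (valr_val c)) => [h|] [g|] //= g0.
  by rewrite -{1}[h]addr0; exact: oag_leD2l.
have [b0|b0] := eqVneq (valr_val b) 0.
  exists 0; rewrite mulr0; apply: valr_val_eq0; apply/(val_oo v).
  by move: ba; rewrite (proj2 (val_oo v _) b0); case: (v _).
have quot_in : valr_val a / valr_val b \in valring v.
  rewrite unfold_in /valring; move: ba.
  rewrite -{1}(divfK b0 (valr_val a)) (val_mul v (_ / _)).
  have : v (valr_val b) <> None by move=> /(val_oo v)/eqP; apply/negP.
  case: (v (valr_val b)) (v (valr_val a / valr_val b)) => [h|] [g|] //= _ hg.
  by have := oag_leD2l (- h) hg; rewrite addNr addrC addrK.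
exists (ValuationRing quot_in); apply: valr_val_inj.
by rewrite valr_valM mulrC divfK.
Qed.

Lemma dvd_total a b : (exists c, a = b * c) \/ (exists c, b = a * c).
Proof.
have [/dvd_valP|/dvd_valP] := oo_le_total (v (valr_val b)) (v (valr_val a)).
  by left.
by right.
Qed.

Lemma valring_inv x : x \notin valring v -> x^-1 \in valring v.
Proof.
have [->|x0] := eqVneq x 0; first by rewrite rpred0.
rewrite !unfold_in /valring.
have := val_mul v x x^-1; rewrite divff // val_mul1.
case: (v x) (v x^-1) => [g|] [h|] //= [gh].
case/orP: (oag_total 0 g) => [-> //|g0 _].
by have := oag_leD2l h g0; rewrite addr0 addrC -gh.
Qed.

Lemma zero_prime : is_prime_ideal [set (0 : Ov)].
Proof.
split.
- split=> // [x y -> ->|r x ->]; first by rewrite addr0.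
  by rewrite mulr0 mul0r.
- apply/eqP => /seteqP[_ /(_ 1 I)] /eqP.
  by rewrite oner_eq0.
- move=> I J idI idJ IJ; apply: contrapT => /not_orP[].
  move=> /existsNP[x /not_implyP[Ix x0]] /existsNP[y /not_implyP[Jy y0]].
  by case: (valuation_ring_domain (IJ x y Ix Jy)).
Qed.

Definition zero_spec : Spec Ov := MkSpec zero_prime.

End ValuationRingArithmetic.

(** * The generic fibre as an algebra over the fraction field *)

Section FractionField.
Variables (F : fieldType) (G : orderedAbGroup) (v : valuation F G).
Local Notation Ov := (valuation_ring v).
Local Notation K := (local_ring (zero_spec v)).
Implicit Types (x y : F) (a b : Ov) (t : denominator (zero_spec v)).

(** For x outside the valuation ring, 1 / x^-1 is a fraction for x. *)
Lemma exists_fraction x : exists f : Ov * denominator (zero_spec v),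
  x * valr_val (den_val f.2) = valr_val f.1.
Proof.
have [xO|xO] := boolP (x \in valring v).
  by exists (ValuationRing xO, den1 _); rewrite /= mulr1.
have x0 : x != 0 by apply: contraNneq xO => ->; rewrite rpred0.
have ne0 : ~ spec_set (zero_spec v) (ValuationRing (valring_inv xO)).
  by move=> /(congr1 val)/eqP; rewrite /= invr_eq0 (negPf x0).
by exists (1, Denominator (asboolT ne0)); rewrite /= divff.
Qed.

Definition fraction_map x : K :=
  let f := projT1 (cid (exists_fraction x)) in \pi_K (f.1, f.2).

(** The chosen fraction does not matter; the algebraic laws below are proved by
    picking the denominators that suit them. *)
Lemma fraction_mapE x a t :
  x * valr_val (den_val t) = valr_val a -> fraction_map x = \pi_K (a, t).
Proof.
rewrite /fraction_map; case: cid => -[b s] /= xs xt.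
apply: (@Localization.eq_frac _ (self_algebra Ov)); apply: valr_val_inj.
rewrite [LHS]valr_valM [RHS]valr_valM -xs -xt.
by rewrite [LHS]mulrC [RHS]mulrC mulrAC.
Qed.

Lemma fraction_map_zmod : zmod_morphism fraction_map.
Proof.
move=> x y; have [[a s] /= xs] := exists_fraction x.
have [[b t] /= yt] := exists_fraction y.
rewrite (fraction_mapE xs) (fraction_mapE yt).
rewrite [X in _ = _ + X]Localization.frac_opp [RHS]Localization.frac_add.
apply: fraction_mapE; rewrite /= -xs -yt mulrBl mulrN.
by congr (_ - _); [rewrite mulrA mulrC|rewrite mulrCA].
Qed.

Lemma fraction_map_monoid : monoid_morphism fraction_map.
Proof.
split.
  rewrite [RHS]Localization.frac1; apply: fraction_mapE.
  by rewrite /= mul1r.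
move=> x y; have [[a s] /= xs] := exists_fraction x.
have [[b t] /= yt] := exists_fraction y.
rewrite (fraction_mapE xs) (fraction_mapE yt) [RHS]Localization.frac_mul.
by apply: fraction_mapE => /=; rewrite -xs -yt mulrACA.
Qed.

HB.instance Definition _ :=
  GRing.isZmodMorphism.Build F K fraction_map fraction_map_zmod.
HB.instance Definition _ :=
  GRing.isMonoidMorphism.Build F K fraction_map fraction_map_monoid.

End FractionField.

Section LocalizationMap.
Variables (S : comPzRingType) (R : algebra S) (P : Spec S).

Definition localize (r : R) : local_algebra R P :=
  \pi_(Localization.type R P) (r, den1 P).

Lemma localize_zmod : zmod_morphism localize.
Proof.
move=> x y; rewrite /localize [X in _ = _ + X]Localization.frac_opp.
rewrite [RHS]Localization.frac_add; apply: Localization.eq_frac => /=.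
by rewrite mulr1 rmorph1 !mul1r.
Qed.

Lemma localize_monoid : monoid_morphism localize.
Proof.
split; first by rewrite [RHS]Localization.frac1.
move=> x y; rewrite [RHS]Localization.frac_mul; apply: Localization.eq_frac.
by rewrite /= mulr1.
Qed.

HB.instance Definition _ :=
  GRing.isZmodMorphism.Build R (local_algebra R P) localize localize_zmod.
HB.instance Definition _ :=
  GRing.isMonoidMorphism.Build R (local_algebra R P) localize localize_monoid.

End LocalizationMap.

Section GenericFibre.
Variables (F : fieldType) (G : orderedAbGroup) (v : valuation F G).
Variable R : algebra (valuation_ring v).
Local Notation P0 := (zero_spec v).

(** F is the localization of the valuation ring at its zero ideal, and the
    structure map of F on the localization of R factors through it. *)
Definition generic_fibre_map : {rmorphism F -> Localization.type R P0} :=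
  alg_map (local_algebra R P0) \o @fraction_map F G v.

Lemma generic_fibre_map_central x y :
  generic_fibre_map x * y = y * generic_fibre_map x.
Proof. exact: (@alg_map_central _ (local_algebra R P0)). Qed.

Definition generic_fibre : algebra F := Algebra generic_fibre_map_central.

Lemma generic_fibre_mapE x (a : valuation_ring v) (t : denominator P0) :
  x * valr_val (den_val t) = valr_val a ->
  alg_map generic_fibre x = \pi_(Localization.type R P0) (alg_map R a, t).
Proof. by move=> /fraction_mapE e; rewrite /= e; exact: local_alg_map_pi. Qed.

Lemma localize_injective : torsion_free_algebra R ->
  injective (@localize _ R P0).
Proof.
move=> tf x y /pi_eqP[u u0]; rewrite mulr1 => /eqP.
rewrite -subr_eq0 -mulrBr => /eqP/tf[//|/eqP]; by rewrite subr_eq0 => /eqP.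
Qed.

End GenericFibre.

(** * Subrings of algebras over the field *)

Section EmbeddingInFAlgebra.
Variables (F : fieldType) (G : orderedAbGroup) (v : valuation F G).
Variable R : algebra (valuation_ring v).
Local Notation Ov := (valuation_ring v).

(** Nonzero scalars are invertible in A, which gives torsion-freeness; if s 1 is
    a unit of R then its inverse in A is s^-1 1, so that s^-1 lies in the
    contraction of R. *)
Lemma embedded_torsion_free_units (A : algebra F) (i : {rmorphism R -> A}) :
    nontrivial_valuation v -> injective i ->
    (forall s : Ov, i (alg_map R s) = alg_map A (valr_val s)) ->
    contraction A (range i) = [set x : F | x \in valring v] ->
  torsion_free_algebra R /\ contraction R (unit_set R) `<=` unit_set Ov.
Proof.
move=> [z z0 vz] inj_i iE capE.
have inv_alg (x : F) : x != 0 -> alg_map A x^-1 * alg_map A x = 1.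
  by move=> x0; rewrite -rmorphM mulVf // rmorph1.
have in_valring x r : i r = alg_map A x -> x \in valring v.
  by move=> ir; have : contraction A (range i) x; [exists r|rewrite capE].
split=> [s r sr0|s [y [sy _]]].
  have [s0|s0] := eqVneq (valr_val s) 0; first by left; apply: valr_val_eq0.
  right; apply: inj_i; rewrite rmorph0 -[i r]mul1r -(inv_alg _ s0) -mulrA -iE.
  by rewrite -rmorphM sr0 rmorph0 mulr0.
have s0 : valr_val s != 0.
  (* If s = 0 then 1 = 0 in A, so all of F is contracted from R and v is
     trivial. *)
  apply/eqP => /valr_val_eq0 s0.
  have all_in x : x \in valring v.
    apply: (in_valring x 0); rewrite rmorph0 -[RHS]mul1r -(rmorph1 i) -sy s0.
    by rewrite rmorph0 mul0r rmorph0 mul0r.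
  case: vz; have := all_in z; have := all_in z^-1.
  rewrite !unfold_in /valring; have := val_mul v z z^-1.
  rewrite divff // val_mul1.
  case: (v z) (v z^-1) => [g|] [h|] //= [gh] h0 g0; congr Some.
  apply/eqP; rewrite eq_le g0 andbT.
  by have := oag_leD2l g h0; rewrite addr0 -gh.
have sV : (valr_val s)^-1 \in valring v.
  apply: (in_valring _ y); rewrite -[i y]mul1r -(inv_alg _ s0) -mulrA -iE.
  by rewrite -rmorphM sy rmorph1 mulr1.
exists (ValuationRing sV).
by split; apply: valr_val_inj; rewrite valr_valM ?divff ?mulVf.
Qed.

(** A is the localization of R at the nonzero scalars.  If x in F is not in the
    valuation ring but equals some r of R inside A, then x^-1 is a scalar with
    inverse r in R, hence a unit of the valuation ring, which is absurd. *)
Lemma torsion_free_units_embedded :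
    torsion_free_algebra R -> contraction R (unit_set R) `<=` unit_set Ov ->
  exists (A : algebra F) (i : {rmorphism R -> A}),
    [/\ injective i,
        forall s : Ov, i (alg_map R s) = alg_map A (valr_val s)
      & contraction A (range i) = [set x : F | x \in valring v]].
Proof.
move=> tf unitP.
pose i : {rmorphism R -> generic_fibre R} := @localize _ R (zero_spec v).
have iE (s : Ov) : i (alg_map R s) = alg_map (generic_fibre R) (valr_val s).
  by apply/esym/generic_fibre_mapE; rewrite mulr1.
have inj_i : injective i := localize_injective tf.
exists (generic_fibre R), i; split=> //.
apply/seteqP; split=> [x [r _ ir]|x xO] /=; last first.
  by exists (alg_map R (ValuationRing xO)) => //; rewrite iE.
apply: contrapT => /negP xO.
have x0 : x != 0 by apply: contraNneq xO => ->; rewrite rpred0.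
pose y := ValuationRing (valring_inv xO).
have yr : alg_map R y * r = 1.
  apply: inj_i; rewrite rmorphM rmorph1 iE ir.
  by rewrite -rmorphM mulVf // rmorph1.
have [|z [yz _]] := unitP y; first by exists r; rewrite -alg_map_central.
case/negP: (xO).
suff -> : x = valr_val z by exact: valr_in.
apply: (mulfI (invr_neq0 x0)); rewrite mulVf //.
by have := congr1 (@valr_val F G v) yz; rewrite valr_valM.
Qed.

End EmbeddingInFAlgebra.

(** * The filter quasi-valuation on scalars *)

Section FilterQuasiValuationOnScalars.
Variables (F : fieldType) (G : orderedAbGroup) (v : valuation F G).
Variable R : algebra (valuation_ring v).
Local Notation Ov := (valuation_ring v).

Lemma initial_cut_eq (L M : set G)
    (Linit : forall a b, L b -> a < b -> L a)
    (Minit : forall a b, M b -> a < b -> M a) :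
  L = M -> initial_cut Linit = initial_cut Minit.
Proof. by move=> LM; subst M; rewrite (Prop_irrelevance Linit Minit). Qed.

Lemma support_set_algP (a b : Ov) :
  support_set (alg_map R a) b <-> exists r, alg_map R b * r = alg_map R a.
Proof.
split=> [/(_ (alg_map R a)) []|[r br] _ [t _ <-]].
- by exists 1; rewrite ?mulr1.
- by move=> r _ br; exists r.
- by exists (r * t); rewrite // -br mulrA.
Qed.

(** The point is that for s <> 0, sR is contained in bR only if b divides s.
    Otherwise b = s c, and s = b r gives c r = 1 after cancelling s; so c is a
    unit and b divides s all the same. *)
Lemma filter_quasi_valuation_scalars :
    torsion_free_algebra R -> contraction R (unit_set R) `<=` unit_set Ov ->
  forall s : Ov,
    filter_quasi_valuation (alg_map R s) = omap (@principal_cut G) (v (valr_val s)).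
Proof.
move=> tf unitP s.
case vs : (v (valr_val s)) => [g|] /=; last first.
  move/(val_oo v)/valr_val_eq0: vs => ->.
  by rewrite rmorph0 /filter_quasi_valuation eqxx.
have s0 : s <> 0 by move=> s0; move: vs; rewrite s0 /= (proj2 (val_oo v 0)).
have R1 : (1 : R) <> 0.
  move=> R1; have [|y []] := unitP 0.
    by exists 0; rewrite /= mulr0 mul0r R1.
  by rewrite mul0r => /eqP; rewrite eq_sym oner_eq0.
rewrite /filter_quasi_valuation; case: eqP => [Rs|_].
  by have [/s0|/R1] : s = 0 \/ 1 = 0 :> R by apply: tf; rewrite mulr1.
congr Some; apply: initial_cut_eq; apply/seteqP; split=> h /=.
  case=> [[b /support_set_algP[r br] vb]|/= h0]; last first.
    have := valr_in s; rewrite unfold_in /valring vs /= => g0.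
    exact: le_trans (ltW h0) g0.
  have [/dvd_valP|[c bE]] := dvd_total s b; first by rewrite vs vb.
  have cr : alg_map R c * r = 1.
    apply/eqP; rewrite -subr_eq0; apply/eqP.
    have [/s0|] // : s = 0 \/ alg_map R c * r - 1 = 0; apply: tf.
    by rewrite mulrBr mulr1 mulrA -rmorphM -bE br subrr.
  have [|d [cd _]] := unitP c; first by exists r; rewrite -alg_map_central.
  have : oo_le (v (valr_val b)) (v (valr_val s)).
    by apply/dvd_valP; exists d; rewrite bE -mulrA cd mulr1.
  by rewrite vs vb.
have Sg : support_values (alg_map R s) g.
  by left; exists s => //; apply/support_set_algP; exists 1; rewrite mulr1.
rewrite le_eqVlt => /orP[/eqP -> //|hg].
exact: support_values_initial Sg hg.
Qed.

(** For q <> 0, from p r = q follows that qR is contained in pR, so v(p) belongs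
    to the lower half of the cut w(q) = v(q); hence v(p) <= v(q), p divides q,
    and q lies in every prime that contains p. *)
Lemma quasi_valuation_scalars_separates (P : Spec Ov) :
    (forall s : Ov,
      filter_quasi_valuation (alg_map R s) =
        omap (@principal_cut G) (v (valr_val s))) ->
  separates_prime R P.
Proof.
move=> wE p q r Pp pr; have [[P0 _ _] _ _] := specP P.
have w0 s : alg_map R s = 0 -> s = 0.
  move=> Rs; have := wE s; rewrite /filter_quasi_valuation Rs eqxx.
  by case vs: (v _) => // _; apply/valr_val_eq0/(val_oo v).
have := wE q; rewrite /filter_quasi_valuation; case: eqP => [/w0 -> //|Rq].
case vq : (v (valr_val q)) => [g|] //= [cutE _].
case vp : (v (valr_val p)) => [h|]; last first.
  case: Rq; rewrite -pr; move/(val_oo v)/valr_val_eq0: vp => ->.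
  by rewrite rmorph0 mul0r.
have : support_values (alg_map R q) h.
  by left; exists p => //; apply/support_set_algP; exists r.
rewrite cutE /= => hg.
have /dvd_valP[c ->] : oo_le (v (valr_val p)) (v (valr_val q)) by rewrite vp vq.
by rewrite mulrC; exact: prime_mulr.
Qed.

End FilterQuasiValuationOnScalars.

(** * Lying over *)

Section LyingOver.
Variables (F : fieldType) (G : orderedAbGroup) (v : valuation F G).
Variable R : algebra (valuation_ring v).
Local Notation Ov := (valuation_ring v).

Lemma separates_zero_faithful :
  separates_prime R (zero_spec v) -> faithful_algebra R.
Proof.
move=> sep0 s sR; apply: (sep0 0 s 0 erefl).
by rewrite mulr0 -(sR 1) mulr1.
Qed.

(** The products p r are closed under addition because, of two elements of the
    valuation ring, one divides the other. *)
Lemma extension_ideal (P : Spec Ov) :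
  is_ideal [set x : R | exists p r, spec_set P p /\ x = alg_map R p * r].
Proof.
have [[P0 _ _] _ _] := specP P; split.
- by exists 0, 0; rewrite mulr0.
- move=> _ _ [p [r [Pp ->]]] [q [t [Pq ->]]].
  have [[c ->]|[c ->]] := dvd_total p q.
    by exists q, (alg_map R c * r + t); rewrite rmorphM mulrDr mulrA.
  by exists p, (r + alg_map R c * t); rewrite rmorphM mulrDr !mulrA.
- move=> s _ [p [r [Pp ->]]]; split.
    by exists p, (s * r); rewrite mulrA -alg_map_central mulrA.
  by exists p, (r * s); rewrite mulrA.
Qed.

(** Separation says that the ideal PR avoids the image of the complement of P; a
    prime of R that contains the former and avoids the latter lies over P. *)
Lemma separates_lying_over (P : Spec Ov) :
  separates_prime R P -> exists Q : Spec R, lying_over Q P.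
Proof.
move=> sepP; pose M := [set alg_map R s | s in ~` spec_set P].
have [| | |Q PQ QM] := @exists_prime_avoiding R _ M (extension_ideal P).
- by exists 1; [exact: prime_not1|rewrite rmorph1].
- move=> _ _ [s Ps <-] [t Pt <-]; exists (s * t); last by rewrite rmorphM.
  exact: prime_notM.
- by move=> _ [p [r [Pp ->]]] [q Pq qE]; apply: Pq; apply: sepP Pp (esym qE).
exists Q; apply/seteqP; split=> s /= => [Qs|Ps].
  by apply: contrapT => Ps; apply: (QM _ Qs); exists s.
by apply: PQ; exists s, 1; rewrite mulr1.
Qed.

Lemma satisfies_LO_separatesP :
  satisfies_LO R <-> forall P : Spec Ov, separates_prime R P.
Proof.
split=> [lo P|sep P]; last exact: separates_lying_over.
by have [Q] := lo P; exact: lying_over_separates.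
Qed.

(** Faithfulness is the instance of separation at the zero ideal. *)
Lemma faithful_local_units_separatesP :
  (faithful_algebra R /\
    forall P : Spec Ov,
      contraction (local_algebra R P) (unit_set (local_algebra R P))
        `<=` unit_set (local_ring P)) <->
  forall P : Spec Ov, separates_prime R P.
Proof.
split=> [[_ unitP] P|sep]; first exact/separates_prime_unitP.
split; first exact: separates_zero_faithful.
by move=> P; apply/separates_prime_unitP.
Qed.

End LyingOver.

Unset Implicit Arguments.

Theorem proposition2p2 (F : fieldType) (G : orderedAbGroup)
    (v : valuation F G) (v_nontrivial : nontrivial_valuation v)
    (R : algebra (valuation_ring v)) :
  let Ov := valuation_ring v in
  let w := @filter_quasi_valuation F G v R in
  let a :=
    exists (A : algebra F) (i : {rmorphism R -> A}),
      [/\ injective i,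
          forall s : Ov, i (alg_map R s) = alg_map A (valr_val s)
        & contraction A (range i) = [set x : F | x \in valring v]] in
  let b :=
    torsion_free_algebra R /\ contraction R (unit_set R) `<=` unit_set Ov in
  let c :=
    forall s : Ov, w (alg_map R s) = omap (@principal_cut G) (v (valr_val s)) in
  let d :=
    faithful_algebra R /\
    forall P : Spec Ov,
      contraction (local_algebra R P) (unit_set (local_algebra R P))
        `<=` unit_set (local_ring P) in
  let e := satisfies_LO R in
  [/\ a <-> b, b -> c, c -> d & d <-> e].
Proof.
move=> Ov w a b c d e; split.
- split=> [[A [i [inj_i iE capE]]]|[tf unitP]].
    exact: embedded_torsion_free_units inj_i iE capE.
  exact: torsion_free_units_embedded.
- by move=> [tf unitP]; exact: filter_quasi_valuation_scalars.
- move=> wE; apply/faithful_local_units_separatesP => P.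
  exact: quasi_valuation_scalars_separates.
- apply: iff_trans (iff_sym (satisfies_LO_separatesP R)).
  exact: faithful_local_units_separatesP.
Qed.
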